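(* Let $\mathbb X,\mathbb Y$ be finite-dimensional Hilbert spaces, $\lambda>0$, $z\in\mathbb X$, $b\in\mathbb Y$. Let $f:\mathbb X\to\mathbb R\cup\{+\infty\}$ be proper, lower semicontinuous and prox-bounded with threshold $\lambda_f>\lambda$, let $A:\mathbb X\to\mathbb Y$ be a surjective linear operator, and assume $\{x\in\operatorname{dom} f: Ax=b\}\neq\emptyset$. Then the dual objective function $\Phi_z:\mathbb Y\to\mathbb R$ satisfies: (i) $\Phi_z$ is continuous, convex and locally Lipschitz on $\mathbb Y$; (ii) the subdifferential of $\Phi_z$ at $y\in\mathbb Y$ is $\partial\Phi_z(y)=\operatorname{co}\big(A\,\operatorname{Prox}_{\lambda f}(z+A^*y)-b\big)$; (iii) if the proximal solution is unique, i.e. $\operatorname{Prox}_{\lambda f}(z+A^*y)$ is a singleton, then $\Phi_z$ is differentiable at $y$ with $\nabla\Phi_z(y)=A\,\operatorname{Prox}_{\lambda f}(z+A^*y)-b$.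
   Context: The dual objective $\Phi_z$ is defined by $-\Phi_z(y)=\inf_{x\in\mathbb X}\{\lambda f(x)+\tfrac12\|x-z\|^2+\langle y,b-Ax\rangle\}$; equivalently $-\Phi_z(y)=E_{\lambda f}(z+A^*y)-\tfrac12\|z+A^*y\|^2+\langle b,y\rangle+\tfrac12\|z\|^2$. For a function $h$, $E_h(t)=\inf_x\{h(x)+\tfrac12\|x-t\|^2\}$ is the Moreau envelope and $\operatorname{Prox}_h(t)=\arg\min_x\{h(x)+\tfrac12\|x-t\|^2\}$ is the (set-valued) proximal mapping. $f$ is prox-bounded if there is $\gamma>0$ with $E_{\gamma f}(x)>-\infty$ for some $x\in\mathbb X$; the supremum $\lambda_f$ of all such $\gamma$ is the threshold of prox-boundedness. $\operatorname{co}$ denotes convex hull, $A^*$ the adjoint of $A$, and $AS-b=\{Ax-b:x\in S\}$ for a set $S\subseteq\mathbb X$. *)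

(* Defs.v *)
From HB Require Import structures.
From mathcomp Require Import all_boot all_order all_algebra.
From mathcomp Require Import sesquilinear.
From mathcomp Require Import all_classical all_reals all_analysis.

Set Implicit Arguments.
Unset Strict Implicit.
Unset Printing Implicit Defensive.

Import Order.TTheory GRing.Theory Num.Theory.
Import numFieldNormedType.Exports.

Local Open Scope classical_set_scope.
Local Open Scope ring_scope.

HB.mixin Record NormedModule_hasInner (R : realType) V
    & NormedModule R V := {
  inner : V -> V -> R;
  innerC : forall u v : V, inner u v = inner v u;
  inner_linearl : forall (a : R) (u v w : V),
    inner (a *: u + v) w = a * inner u w + inner v w;
  sqr_normE : forall u : V, `|u| ^+ 2 = inner u u
}.

(* Real Hilbert spaces of finite dimension: the norm and the topology of the
   normed module are those of the inner product, and completeness follows from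
   finite dimensionality. *)
#[short(type="finHilbertType")]
HB.structure Definition FinHilbert (R : realType) :=
  {V of NormedModule R V & Vector R V & NormedModule_hasInner R V}.

Section InnerIsDot.
Context {R : realType} {V : finHilbertType R}.

Let inner_bilinear : bilinear_for *%R *%R (@inner R V).
Proof.
by split=> [u' a u v|u a v w]; rewrite ?[inner u _]innerC inner_linearl //
  ![inner _ u]innerC.
Qed.

HB.instance Definition _ := bilinear_isBilinear.Build R V V R *%R *%R
  (@inner R V) inner_bilinear.

Let inner_sym (u v : V) : inner u v = (-1) ^+ false * idfun (inner v u).
Proof. by rewrite /= expr0 mul1r innerC. Qed.

HB.instance Definition _ := isHermitianSesquilinear.Build R V false idfun
  (@inner R V) inner_sym.

Let inner_gt0 (u : V) : u != 0 -> 0 < inner u u.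
Proof. by move=> u0; rewrite -sqr_normE exprn_gt0 ?normr_gt0. Qed.

HB.instance Definition _ := isDotProduct.Build R V (@inner R V) inner_gt0.

End InnerIsDot.

Section Adjoint.
Context {R : realType}.

Lemma riesz (X : finHilbertType R) (l : {linear X -> R^o}) :
  exists v : X, forall x, l x = inner x v.
Proof.
have inner_lin (v : X) : linear (inner^~ v : X -> R^o).
  by move=> a x y; rewrite inner_linearl.
pose I v : {linear X -> R^o} :=
  HB.pack (inner^~ v : X -> R^o) (GRing.isLinear.Build _ _ _ _ _ (inner_lin v)).
pose T (v : X) : 'Hom(X, R^o) := linfun (I v).
have TE v x : T v x = inner x v by rewrite lfunE.
have T_lin : linear T.
  move=> a u v; apply/lfunP => x.
  by rewrite add_lfunE scale_lfunE !TE innerC inner_linearl ![inner _ x]innerC.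
pose TL : {linear X -> 'Hom(X, R^o)} :=
  HB.pack T (GRing.isLinear.Build _ _ _ _ T T_lin).
have kerT : lker (linfun TL) == 0%VS.
  apply/lker0P => u v; rewrite !lfunE /= => Tuv.
  have Iuv x : inner x u = inner x v by rewrite -!TE Tuv.
  have uv0 : inner (u - v) (u - v) = 0 by rewrite linearBr /= Iuv subrr.
  by apply/eqP; rewrite -subr_eq0 -normr_eq0 -sqrf_eq0 sqr_normE uv0.
have imT : limg (linfun TL) = fullv.
  apply/eqP; rewrite eqEdim subvf /= limg_dim_eq; last first.
    by rewrite (eqP kerT) capv0.
  by rewrite !dimvf /dim /= muln1.
have : linfun l \in limg (linfun TL) by rewrite imT memvf.
move=> /memv_imgP[v _ lv]; exists v => x.
by rewrite -[LHS](lfunE l) lv lfunE /= TE.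
Qed.

Definition adjoint (X Y : finHilbertType R) (A : {linear X -> Y}) (y : Y) : X :=
  get [set v | forall x, inner (A x) y = inner x v].

Lemma adjointP (X Y : finHilbertType R) (A : {linear X -> Y}) (x : X) (y : Y) :
  inner (A x) y = inner x (adjoint A y).
Proof.
pose l (x : X) : R^o := inner (A x) y.
have l_lin : linear l.
  by move=> a u v; rewrite /l linearP inner_linearl.
pose L : {linear X -> R^o} := HB.pack l (GRing.isLinear.Build _ _ _ _ l l_lin).
have [v lv] := riesz L.
exact: (@getPex _ [set v | forall x, inner (A x) y = inner x v]
  (ex_intro _ v lv) x).
Qed.

End Adjoint.

Section VariationalAnalysis.
Context {R : realType}.
Implicit Types (X Y : finHilbertType R).
Local Open Scope ereal_scope.

Definition edom X (f : X -> \bar R) : set X := [set x | f x < +oo].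

Definition proper_efun X (f : X -> \bar R) : Prop :=
  (forall x, -oo < f x) /\ edom f !=set0.

Definition scale_fun X (gamma : R) (f : X -> \bar R) : X -> \bar R :=
  fun x => gamma%:E * f x.

Definition prox_objective X (h : X -> \bar R) (t : X) : X -> \bar R :=
  fun x => h x + (2^-1 * `|x - t| ^+ 2)%:E.

Definition moreau_envelope X (h : X -> \bar R) (t : X) : \bar R :=
  ereal_inf (range (prox_objective h t)).

Definition prox X (h : X -> \bar R) (t : X) : set X :=
  [set x | forall x', prox_objective h t x <= prox_objective h t x'].

Definition prox_bound_set X (f : X -> \bar R) : set R :=
  [set gamma | (0 < gamma)%R /\
    exists x, -oo < moreau_envelope (scale_fun gamma f) x].

Definition prox_bounded X (f : X -> \bar R) : Prop := prox_bound_set f !=set0.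

Definition prox_threshold X (f : X -> \bar R) : \bar R :=
  ereal_sup (EFin @` prox_bound_set f).

Definition dual_objective X Y (lambda : R) (f : X -> \bar R)
    (A : {linear X -> Y}) (z : X) (b : Y) (y : Y) : \bar R :=
  - ereal_inf (range (fun x =>
      scale_fun lambda f x + (2^-1 * `|x - z| ^+ 2)%:E
        + (inner y (b - A x))%:E)).

End VariationalAnalysis.

Section ConvexAnalysis.
Context {R : realType} {Y : finHilbertType R}.

Definition convex_hull (S : set Y) : set Y :=
  smallest (@convex_set R Y) S.

Definition subdifferential (f : Y -> R^o) (y : Y) : set Y :=
  [set g | forall y', f y + inner g (y' - y) <= f y'].

Definition is_gradient (f : Y -> R^o) (y g : Y) : Prop :=
  differentiable f y /\ forall v, 'd f y v = inner g v.

End ConvexAnalysis.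

(* Main.v *)
From HB Require Import structures.
Require Import Defs.
From mathcomp Require Import all_boot all_order all_algebra.
From mathcomp Require Import all_classical all_reals all_analysis.
From mathcomp Require Import ring lra.
Import Order.TTheory GRing.Theory Num.Theory.
Import numFieldNormedType.Exports.
Local Open Scope classical_set_scope.
Local Open Scope ring_scope.

(** Put h x = lambda f x + 1/2 |x - z|^2. The dual function is then
    phi y = max_x (<y, A x - b> - h x), a pointwise maximum of affine functions
    of y, and everything is read off from its maximizers P y.

    Since lambda lies strictly below the threshold of f, some gamma > lambda
    has gamma f + 1/2 |. - x0|^2 bounded below; scaling by lambda / gamma < 1
    leaves a positive multiple of |x|^2 in h (regularized_coercive). With lower
    semicontinuity and compactness of closed balls this makes phi finite, P y
    nonempty (minimizers_neq0), and P locally bounded with closed graph, hence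
    upper semicontinuous (minimizers_usc). Completing the square identifies
    P y with the proximal set at z + A^* y (prox_argmin).

    Each x in P y gives an affine minorant of phi touching it at y with slope
    A x - b (dual_ge_affine). Comparing the minorants at two points gives the
    local Lipschitz bound; convexity follows from the minorants at the
    intermediate point; and all slopes A x - b, hence their convex
    hull, are subgradients.

    Conversely let g be a subgradient at y and d a direction. Comparing, for
    small t > 0, the affine minorant at y + t d with the subgradient inequality
    gives x_t in P (y + t d) with <A x_t - b, d> >= <g, d>, and upper
    semicontinuity brings such a point into P y. So g is below the support
    function of the compact set A (P y) - b, and mem_convex_hull_compact puts
    it in the convex hull itself. No closure is needed there: by
    Caratheodory, points of the hull are combinations of at most dim + 1
    points, so that these combinations form a compact set.

    If P y = {x}, upper semicontinuity forces the slopes at y + v to tend to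
    A x - b as v tends to 0; phi (y + v) - phi y - <A x - b, v> lies between
    0 and the product of |v| and the change of slope, which is the
    differentiability of phi at y. *)

(** * Inner products and compactness of balls *)

Section InnerProduct.
Context {R : realType} {V : finHilbertType R}.
Implicit Types u v w : V.

Lemma innerDl u v w : inner (u + v) w = inner u w + inner v w.
Proof. by have := inner_linearl 1 u v w; rewrite scale1r mul1r. Qed.

Lemma inner0l w : inner (0 : V) w = 0.
Proof. by apply: (addrI (inner 0 w)); rewrite -innerDl !addr0. Qed.

Lemma innerZl a u w : inner (a *: u) w = a * inner u w.
Proof. by have := inner_linearl a u 0 w; rewrite !addr0 inner0l addr0. Qed.

Lemma innerNl u w : inner (- u) w = - inner u w.
Proof. by rewrite -scaleN1r innerZl mulN1r. Qed.

Lemma innerBl u v w : inner (u - v) w = inner u w - inner v w.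
Proof. by rewrite innerDl innerNl. Qed.

Lemma innerDr u v w : inner u (v + w) = inner u v + inner u w.
Proof. by rewrite !(innerC u) innerDl. Qed.

Lemma innerZr a u w : inner u (a *: w) = a * inner u w.
Proof. by rewrite !(innerC u) innerZl. Qed.

Lemma innerNr u w : inner u (- w) = - inner u w.
Proof. by rewrite !(innerC u) innerNl. Qed.

Lemma innerBr u v w : inner u (v - w) = inner u v - inner u w.
Proof. by rewrite innerDr innerNr. Qed.

Lemma sqr_normB u v : `|u - v| ^+ 2 = `|u| ^+ 2 - 2 * inner u v + `|v| ^+ 2.
Proof.
by rewrite !sqr_normE innerBl !innerBr (innerC v u); ring.
Qed.

(** Cauchy-Schwarz: |v|^2 times the gap between the squares of both sides is the
    squared norm of |v|^2 u - <u, v> v, the rescaled component of u orthogonal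
    to v. *)
Lemma normr_inner_le u v : `|inner u v| <= `|u| * `|v|.
Proof.
have [->|v0] := eqVneq v 0; first by rewrite innerC inner0l !normr0 mulr0.
have v2 : 0 < `|v| ^+ 2 by rewrite exprn_gt0 ?normr_gt0.
rewrite -ler_sqr ?nnegrE ?mulr_ge0// exprMn real_normK ?num_real//.
rewrite -(ler_pM2l v2) -subr_ge0.
have -> : `|v| ^+ 2 * (`|u| ^+ 2 * `|v| ^+ 2) - `|v| ^+ 2 * inner u v ^+ 2 =
    `| (`|v| ^+ 2) *: u - inner u v *: v | ^+ 2.
  by rewrite (sqr_normB (_ *: u) (_ *: v)) !sqr_normE !innerZl !innerZr; ring.
exact: sqr_ge0.
Qed.

Lemma inner_le u v : inner u v <= `|u| * `|v|.
Proof. exact: le_trans (ler_norm _) (normr_inner_le u v). Qed.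

End InnerProduct.

(** The coordinate forms in a basis are inner products with fixed vectors by
    Riesz, so Cauchy-Schwarz bounds each of them, and a linear map is a finite
    combination of coordinates. *)
Lemma linear_bounded_finHilbert {R : realType} {V : finHilbertType R}
    {W : normedModType R} (L : {linear V -> W}) :
  exists2 C, 0 <= C & forall x, `|L x| <= C * `|x|.
Proof.
pose e := vbasis (fullv : {vspace V}).
have /choice[w wE] : forall i, exists w, forall x, coord e i x = inner x w.
  by move=> i; exact: (riesz (coord e i)).
exists (\sum_i `|w i| * `|L e`_i|).
  by apply: sumr_ge0 => i _; exact: mulr_ge0.
move=> x; rewrite {1}(coord_vbasis (memvf x)) linear_sum /=.
apply: le_trans (ler_norm_sum _ _ _) _.
rewrite mulr_suml; apply: ler_sum => i _.
rewrite linearZ /= normrZ wE mulrAC ler_wpM2r// mulrC.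
exact: normr_inner_le.
Qed.

Lemma linear_continuous_finHilbert {R : realType} {V : finHilbertType R}
    {W : normedModType R} (L : {linear V -> W}) : continuous L.
Proof.
have [C C0 LC] := linear_bounded_finHilbert L.
apply/bounded_linear_continuous/linear_boundedP.
near=> r => x; apply: le_trans (LC x) _; rewrite ler_wpM2r//.
Unshelve. all: by end_near. Qed.

(** Coordinates are bounded on the ball, so the ball is a closed subset of the
    image of a box of coefficients, which is compact by Tychonoff. *)
Lemma compact_norm_le {R : realType} {V : finHilbertType R} (r : R) :
  compact [set v : V | `|v| <= r].
Proof.
pose e := vbasis (fullv : {vspace V}).
have /choice[C CP] : forall i, exists C, forall x : V,
    `|coord e i x| <= C * `|x|.
  move=> i; have [C _ CP] := linear_bounded_finHilbert (coord e i).
  by exists C.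
have eE (v : V) : v = \sum_i coord e i v *: e`_i.
  exact: coord_vbasis (memvf v).
move: e eE C CP; set n := \dim _ => e eE C CP.
pose box : set (prod_topology (fun _ : 'I_n => R)) :=
  [set c | forall i, [set` `[- (`|C i| * r), `|C i| * r]] (c i)].
have cbox : compact box.
  apply: (@tychonoff 'I_n (fun=> R)
    (fun i => [set` `[- (`|C i| * r), `|C i| * r]])) => i.
  exact: segment_compact.
pose g (c : prod_topology (fun _ : 'I_n => R)) : V := \sum_i c i *: e`_i.
have cg : continuous g.
  apply: (@continuous_big _ _ +%R) => [|i _ c]; first exact: add_continuous.
  have pc : c' i @[c' --> c] --> c i.
    exact: (@proj_continuous _ (fun=> R) i c).
  exact: (@cvgZr_tmp R V _ _ _ _ _ e`_i pc).
apply: (@subclosed_compact _ _ (g @` box)).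
- have /continuous_closedP := @norm_continuous R V.
  by move=> /(_ _ (@closed_le R r)).
- by apply: continuous_compact => //; exact: continuous_subspaceT.
move=> v /= vr; exists (fun i => coord e i v); last first.
  exact: esym (eE v).
move=> i; rewrite /= in_itv /= -ler_norml; apply: le_trans (CP i v) _.
apply: (@le_trans _ _ (`|C i| * `|v|)).
  by rewrite ler_wpM2r// ler_norm.
by rewrite ler_wpM2l.
Qed.

(** * Convex hulls of compact sets *)

Lemma convex_setP {R : realType} {V : lmodType R} (D : set V) :
  @convex_set R V D <-> (forall x y t, D x -> D y -> 0 <= t <= 1 ->
    D (t *: x + (1 - t) *: y)).
Proof.
split=> [cD x y t Dx Dy /andP[t0 t1]|cD x y l /set_mem Dx /set_mem Dy].
  have := cD x y (Itv01 t0 t1) (mem_set Dx) (mem_set Dy).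
  by rewrite inE.
apply/mem_set; apply: (cD _ _ _ Dx Dy).
by rewrite ge0 le1.
Qed.

Definition convex_combs {R : realType} {V : lmodType R} (n : nat) (K : set V)
    : set V :=
  [set v | exists a : 'I_n -> R, exists k : 'I_n -> V,
    [/\ forall i, 0 <= a i, \sum_i a i = 1, forall i, K (k i)
      & v = \sum_i a i *: k i]].

Lemma convex_combs_sub {R : realType} {V : lmodType R} (K D : set V) n :
  @convex_set R V D -> K `<=` D -> convex_combs n K `<=` D.
Proof.
move=> /convex_setP cD KD; elim: n => [|n IH] _ [a [k [a0 a1 Kk ->]]].
  by move: a1; rewrite big_ord0 => /esym/eqP; rewrite oner_eq0.
move: a1; rewrite !big_ord_recl => a1.
set b := \sum_i a (lift ord0 i) in a1.
have b0 : 0 <= b by apply: sumr_ge0.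
have [b00|b_neq0] := eqVneq b 0.
  rewrite big1 => [|i _].
    by rewrite addr0 -[a _](addr0) -b00 a1 scale1r; exact/KD.
  by rewrite (psumr_eq0P _ b00) ?scale0r.
have -> : a ord0 *: k ord0 + \sum_i a (lift ord0 i) *: k (lift ord0 i) =
    a ord0 *: k ord0 +
    (1 - a ord0) *: (\sum_i (b^-1 * a (lift ord0 i)) *: k (lift ord0 i)).
  congr +%R; have -> : 1 - a ord0 = b by rewrite -a1 addrAC subrr add0r.
  rewrite scaler_sumr; apply: eq_bigr => i _.
  by rewrite scalerA mulrA divff// mul1r.
apply: cD; [exact/KD| |by rewrite a0 -a1 lerDl].
apply: IH; exists (fun i => b^-1 * a (lift ord0 i)), (fun i => k (lift ord0 i)).
by split=> // [i|]; [rewrite mulr_ge0 ?invr_ge0|rewrite -mulr_sumr mulVf].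
Qed.

(** Caratheodory's reduction. More than dim + 1 points satisfy an affine
    dependence d; moving the weights along d until the first of them vanishes
    keeps the combination and frees one point. *)
Lemma convex_combs_drop {R : realType} {V : vectType R} (K : set V) m :
  (\dim (fullv : {vspace V}) <= m)%N ->
  convex_combs m.+2 K `<=` convex_combs m.+1 K.
Proof.
move=> dimm _ [a [k [a0 a1 Kk ->]]].
pose X := [tuple k (lift ord0 i) - k ord0 | i < m.+1].
have /freeP : ~~ free X.
  apply/negP; rewrite /free size_tuple => /eqP Xm.
  by have := dimvS (subvf <<X>>%VS); rewrite Xm leqNgt ltnS dimm.
move=> /existsNP[c /not_implyP[cX /existsNP[j /eqP cj]]].
(* the dependence c between the differences k i - k 0, with the coefficient of
   k 0 that makes the total weight 0 *)
pose d i : R := if unlift ord0 i is Some i' then c i' else - \sum_i c i.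
have dl i : d (lift ord0 i) = c i by rewrite /d liftK.
have d0 : d ord0 = - \sum_i c i by rewrite /d unlift_none.
have sd : \sum_i d i = 0.
  by rewrite big_ord_recl d0 (eq_bigr _ (fun i _ => dl i)) addNr.
have sdk : \sum_i d i *: k i = 0.
  rewrite big_ord_recl d0 (eq_bigr (fun i => c i *: k (lift ord0 i))).
    2: by move=> i _; rewrite dl.
  rewrite scaleNr scaler_suml -sumrN -big_split /= -[RHS]cX.
  apply: eq_bigr => i _.
  by rewrite -tnth_nth tnth_mktuple scalerBr addrC.
have /existsP[i1 di1] : [exists i, 0 < d i].
  apply: contraT => /existsPn nd.
  have /(psumr_eq0P _) dz : \sum_i - d i = 0 by rewrite sumrN sd oppr0.
  case/negP: cj; rewrite -dl -oppr_eq0; apply/eqP/dz => // i _.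
  by rewrite oppr_ge0 leNgt nd.
case: (@arg_minP _ R _ i1 (fun i => 0 < d i) (fun i => a i / d i) di1)
  => i0 di0 mini0.
pose t := a i0 / d i0.
have t0 : 0 <= t by exact: divr_ge0 (a0 _) (ltW di0).
pose a' i := a i - t * d i.
have a'i0 : a' i0 = 0 by rewrite /a' /t divfK ?subrr// gt_eqF.
have a'0 i : 0 <= a' i.
  rewrite subr_ge0; have [di|di] := ltP 0 (d i).
    by rewrite -ler_pdivlMr//; exact: mini0.
  by apply: le_trans (a0 i); rewrite mulr_ge0_le0.
have a'1 : \sum_i a' i = 1 by rewrite sumrB -mulr_sumr sd mulr0 subr0.
have a'k : \sum_i a i *: k i = \sum_i a' i *: k i.
  under [RHS]eq_bigr do rewrite scalerBl -scalerA.
  by rewrite sumrB -scaler_sumr sdk scaler0 subr0.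
exists (fun j => a' (lift i0 j)), (fun j => k (lift i0 j)); split=> //.
  by rewrite -a'1 (bigD1_ord i0)//= a'i0 add0r.
by rewrite a'k (bigD1_ord i0)//= a'i0 scale0r add0r.
Qed.

(** The combinations of n points are the continuous image of the closed set of
    weights of total 1 in the compact box [0, 1]^n * K^n. *)
Lemma compact_convex_combs {R : realType} {V : normedModType R} n (K : set V) :
  compact K -> compact (convex_combs n K).
Proof.
move=> cK.
pose T := prod_topology (fun _ : 'I_n => (R * V)%type).
pose box : set T := [set c | forall i, ([set` `[0, 1]] `*` K) (c i)].
have cbox : compact box.
  apply: (@tychonoff 'I_n (fun=> (R * V)%type)
    (fun=> [set` `[0, 1]] `*` K)) => i.
  by apply: compact_setX => //; exact: segment_compact.
have pc i : continuous (fun c : T => c i).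
  exact: (@proj_continuous _ (fun=> (R * V)%type) i).
pose s (c : T) : R := \sum_i (c i).1.
have sc : continuous s.
  apply: (@continuous_big _ _ +%R) => [|i _ c]; first exact: add_continuous.
  exact: (cvg_comp _ _ (pc i c) cvg_fst).
pose g (c : T) : V := \sum_i (c i).1 *: (c i).2.
have gc : continuous g.
  apply: (@continuous_big _ _ +%R) => [|i _ c]; first exact: add_continuous.
  have p1 : (c' i).1 @[c' --> c] --> (c i).1.
    exact: (cvg_comp _ _ (pc i c) cvg_fst).
  have p2 : (c' i).2 @[c' --> c] --> (c i).2.
    exact: (cvg_comp _ _ (pc i c) cvg_snd).
  exact: (cvgZ p1 p2).
have -> : convex_combs n K = g @` (box `&` s @^-1` [set 1]).
  apply/seteqP; split=> [_ [a [k [a0 a1 Kk ->]]]|_ [c [cb c1] <-]].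
    exists (fun i => (a i, k i)) => //; split=> // i; split=> //=.
    rewrite in_itv /= a0 -a1 (bigD1 i)//= lerDl.
    by apply: sumr_ge0.
  exists (fun i => (c i).1), (fun i => (c i).2); split=> //.
    by move=> i; have [/=] := cb i; rewrite in_itv /= => /andP[].
  by move=> i; have [] := cb i.
apply: continuous_compact; first exact: continuous_subspaceT.
apply: compact_closedI => //.
move/continuous_closedP: sc; apply; exact: closed_eq.
Qed.

(** Separation without closure: let p be the point nearest to g among the
    combinations of dim + 1 points of K. If p <> g, the hypothesis in the
    direction g - p gives a point k of K towards which p can move to come
    closer to g, and Caratheodory's reduction brings the new point back to a
    combination of dim + 1 points. *)
Lemma mem_convex_hull_compact {R : realType} {V : finHilbertType R}
    (K : set V) (g : V) : compact K ->
  (forall d, exists2 k, K k & inner g d <= inner k d) ->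
  convex_hull K g.
Proof.
move=> cK gK D [cD KD].
set m := \dim (fullv : {vspace V}).
suff : convex_combs m.+1 K g by exact: convex_combs_sub.
have cH := @compact_convex_combs R V m.+1 K cK.
have H0 : convex_combs m.+1 K !=set0.
  have [k Kk _] := gK 0; exists k.
  exists (fun i => (i == ord0)%:R), (fun=> k); split=> //.
    by rewrite (bigD1 ord0)//= big1 ?addr0// => i /negPf ->.
  by rewrite -scaler_suml (bigD1 ord0)//= big1 ?addr0 ?scale1r// => i /negPf ->.
have dc : continuous (fun p : V => `|g - p|).
  move=> p; apply: cvg_norm; apply: cvgB; [exact: cvg_cst|exact: cvg_id].
have [p /set_mem Hp minp] := compact_EVT_min H0 cH (continuous_subspaceT dc).
have [<-//|gp] := eqVneq p g.
have d0 : 0 < `|g - p| ^+ 2 by rewrite exprn_gt0// normr_gt0 subr_eq0 eq_sym.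
have [k Kk gk] := gK (g - p).
have kp : `|g - p| ^+ 2 <= inner (g - p) (k - p).
  by rewrite sqr_normE (innerC _ (k - p)) !innerBl lerD2r.
have Ht (t : R) : 0 <= t <= 1 ->
    convex_combs m.+1 K (t *: k + (1 - t) *: p).
  move=> /andP[t0 t1]; apply: convex_combs_drop => //.
  have [a [q [a0 a1 Kq ->]]] := Hp.
  exists (fun i => if unlift ord0 i is Some j then (1 - t) * a j else t).
  exists (fun i => if unlift ord0 i is Some j then q j else k); split.
  - by move=> i /=; case: unliftP => [j _|_] //; rewrite mulr_ge0// subr_ge0.
  - rewrite big_ord_recl /= unlift_none; under eq_bigr do rewrite liftK.
    by rewrite -mulr_sumr a1 mulr1 addrC subrK.
  - by move=> i /=; case: unliftP.
  - rewrite [in RHS]big_ord_recl /= unlift_none.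
    under [in RHS]eq_bigr do rewrite liftK.
    by rewrite scaler_sumr; congr +%R; apply: eq_bigr => i _; rewrite scalerA.
have q0 : 0 <= `|k - p| ^+ 2 by exact: sqr_ge0.
(* a step in ]0, 1] with t |k - p|^2 <= |g - p|^2, so that the decrease
   by at least 2 t |g - p|^2 beats the quadratic term t^2 |k - p|^2 *)
pose t := `|g - p| ^+ 2 / (`|g - p| ^+ 2 + `|k - p| ^+ 2).
have t0 : 0 < t by rewrite divr_gt0// ltr_wpDr.
have t1 : t <= 1 by rewrite ler_pdivrMr ?mul1r ?lerDl// ltr_wpDr.
have tq : t * `|k - p| ^+ 2 <= `|g - p| ^+ 2.
  by rewrite mulrAC ler_pdivrMr ?ltr_wpDr// ler_pM2l// lerDr ltW.
have := minp _ (mem_set (Ht t _)); rewrite (ltW t0) t1 => /(_ isT).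
have -> : g - (t *: k + (1 - t) *: p) = (g - p) - t *: (k - p).
  by rewrite scalerBl scalerBr scale1r !opprD !opprK !addrA [g - _ - _]addrAC.
rewrite -ler_sqr ?nnegrE// (sqr_normB (g - p)) normrZ innerZr exprMn.
rewrite (ger0_norm (ltW t0)).
nra.
Qed.

(** * Continuity and semicontinuity *)

(** By polarization, from the continuity of the norm. *)
Lemma inner_continuous {R : realType} {V : finHilbertType R} :
  continuous (fun p : V * V => inner p.1 p.2).
Proof.
move=> p.
have -> : (fun p : V * V => inner p.1 p.2) =
    (fun p => 2^-1 * (`|p.1| * `|p.1| + `|p.2| * `|p.2|
      - `|p.1 - p.2| * `|p.1 - p.2|)).
  by apply/funext => q; rewrite -!expr2 sqr_normB; field.
have c1 : (q.1 : V) @[q --> p] --> p.1 by exact: cvg_fst.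
have c2 : (q.2 : V) @[q --> p] --> p.2 by exact: cvg_snd.
apply: cvgM; first exact: cvg_cst.
apply: cvgB; first apply: cvgD.
- by apply: cvgM; exact: cvg_norm.
- by apply: cvgM; exact: cvg_norm.
- by apply: cvgM; apply: cvg_norm; exact: cvgB.
Qed.

Lemma lte_fin_between {R : realType} (a : R) (x : \bar R) :
  (a%:E < x)%E -> exists2 c : R, a < c & (c%:E < x)%E.
Proof.
case: x => [r| |//]; last by exists (a + 1); rewrite ?ltrDl ?ltry.
rewrite lte_fin => ar; exists (2^-1 * (a + r)); first lra.
by rewrite lte_fin; lra.
Qed.

(** Lower semicontinuity at a point survives adding a continuous function; it
    is stated pointwise so that it applies to functions on a product that are
    semicontinuous in one variable. *)
Lemma near_lt_lsc_add {R : realType} {T : topologicalType} (F : T -> \bar R)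
    (k : T -> R) (x : T) (a : R) :
  (forall a' : R, (a'%:E < F x)%E -> \forall y \near x, (a'%:E < F y)%E) ->
  {for x, continuous k} -> (a%:E < F x + (k x)%:E)%E ->
  \forall y \near x, (a%:E < F y + (k y)%:E)%E.
Proof.
move=> F_lsc kc; rewrite -lteBlDr// -EFinB => /lte_fin_between[a1 a_lt a1_lt].
have near_F := F_lsc _ a1_lt.
have near_k : \forall y \near x, a - a1 < k y.
  by have /cvgr_gt := kc; apply; lra.
near=> y; have -> : a%:E = (a1%:E + (a - a1)%:E)%E by rewrite -EFinD subrKC.
by rewrite lteD//; [near: y|rewrite lte_fin; near: y].
Unshelve. all: by end_near. Qed.

Lemma near_dist_lt {R : realType} {V : normedModType R} (v : V) (e : R) :
  0 < e -> \forall w \near v, `|v - w| < e.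
Proof. by move=> e0; have /cvgrPdist_lt := @cvg_id _ (nbhs v); apply. Qed.

Lemma near_norm_le {R : realType} {V : normedModType R} (v : V) :
  \forall w \near v, `|w| <= `|v| + 1.
Proof.
near=> w; rewrite -[w](subrK v) addrC; apply: le_trans (ler_normD _ _) _.
by rewrite lerD2l distrC ltW//; near: w; exact: near_dist_lt.
Unshelve. all: by end_near. Qed.

(** * The dual function of a coercive lower semicontinuous function *)

Section Lagrangian.
Context {R : realType} {X Y : finHilbertType R}.
Context (h : X -> \bar R) (A : {linear X -> Y}) (b : Y).

Definition lagrangian (y : Y) (x : X) : \bar R :=
  (h x + (inner y (b - A x))%:E)%E.

Definition lagrangian_argmin (y : Y) : set X :=
  [set x | forall x', (lagrangian y x <= lagrangian y x')%E].

Definition dual_value (y : Y) : R^o :=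
  fine (- ereal_inf (range (lagrangian y)))%E.

End Lagrangian.

Section DualOfCoercive.
Context {R : realType} {X Y : finHilbertType R}.
Context (h : X -> \bar R) (A : {linear X -> Y}) (b : Y).
Context (c beta : R) (x0 : X).
Context (c_gt0 : 0 < c).
Context (h_coercive : forall x, ((c * `|x| ^+ 2 - beta)%:E <= h x)%E).
Context (h_lsc : lower_semicontinuous h).
Context (h_x0 : (h x0 < +oo)%E).

Local Notation L := (lagrangian h A b).
Local Notation phi := (dual_value h A b).
Local Notation minimizers := (lagrangian_argmin h A b).

(** Quadratic growth of h dominates the term <y, A x>, which is linear in |x|,
    uniformly for y in a ball. *)
Lemma lagrangian_level_bounded (r s : R) : 0 <= r ->
  exists M, forall y x, `|y| <= r -> (L y x <= s%:E)%E -> `|x| <= M.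
Proof.
move=> r0; have [C C0 AC] := linear_bounded_finHilbert A.
exists (1 + (`|beta + s + r * `|b| | + r * C) / c) => y x yr.
move=> /(le_trans (leeD2r _ (h_coercive x))); rewrite -EFinD lee_fin innerBr.
have nA : inner y (A x) <= r * C * `|x|.
  apply: le_trans (inner_le _ _) _; rewrite -mulrA.
  by apply: ler_pM.
have nb : - inner y b <= r * `|b|.
  rewrite -innerNr; apply: le_trans (inner_le _ _) _.
  by rewrite normrN ler_wpM2r.
move=> le_s; have := ler_norm (beta + s + r * `|b|).
set d := `|beta + _ + _| => ge_d; have d0 : 0 <= d by exact: normr_ge0.
rewrite leNgt; apply/negP; rewrite -ltrBrDl ltr_pdivrMr// => lt_x.
have rC : 0 <= r * C by exact: mulr_ge0.
have x1 : 1 <= `|x|.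
  have : 0 < (`|x| - 1) * c by apply: le_lt_trans lt_x; exact: addr_ge0.
  by rewrite pmulr_lgt0// subr_gt0 => /ltW.
have : (d + r * C) * `|x| <= (`|x| - 1) * c * `|x| by rewrite ler_wpM2r// ltW.
have : d <= d * `|x| by rewrite ler_peMr.
have : 0 < c * `|x| by rewrite mulr_gt0// (lt_le_trans ltr01).
nra.
Qed.

Lemma lagrangian_lsc y x (a : R) : (a%:E < L y x)%E ->
  \forall p \near (y, x), (a%:E < L p.1 p.2)%E.
Proof.
move=> a_lt.
pose k (p : Y * X) : R := inner p.1 (b - A p.2).
have kc : continuous k.
  move=> p.
  have cA : A q.2 @[q --> p] --> A p.2.
    have c2 : q.2 @[q --> p] --> p.2 by exact: cvg_snd.
    by apply: continuous_cvg c2; exact: linear_continuous_finHilbert.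
  have cb : b - A q.2 @[q --> p] --> b - A p.2.
    by apply: cvgB => //; exact: cvg_cst.
  exact: (cvg_comp _ _ (cvg_pair cvg_fst cb)
    (inner_continuous (p.1, b - A p.2))).
apply: (@near_lt_lsc_add R _ (fun p : Y * X => h p.2) k (y, x)) => //.
  move=> a' /h_lsc[U Ux Uh].
  have Ux2 : \forall p \near (y, x), U p.2 by apply: cvg_snd.
  by near=> p; apply: Uh; near: p.
exact: kc.
Unshelve. all: by end_near. Qed.

Lemma lagrangian_x0_fin y : exists s : R, L y x0 = s%:E.
Proof.
have := h_x0; have := h_coercive x0; rewrite /lagrangian.
by case: (h x0) => // s _ _; eexists; rewrite -EFinD.
Qed.

Lemma lagrangian_lower_bounded y : exists m : R, forall x, (m%:E <= L y x)%E.
Proof.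
have [C C0 AC] := linear_bounded_finHilbert A.
exists (- beta - `|y| * `|b| - (`|y| * C) ^+ 2 / c) => x.
apply: le_trans (leeD2r _ (h_coercive x)); rewrite -EFinD lee_fin innerBr.
have nA : inner y (A x) <= `|y| * C * `|x|.
  by apply: le_trans (inner_le _ _) _; rewrite -mulrA ler_wpM2l.
have nb : - inner y b <= `|y| * `|b|.
  by rewrite -innerNr; apply: le_trans (inner_le _ _) _; rewrite normrN.
set d := `|y| * C in nA *.
(* with e = d / c and n = |x|, it remains that c n^2 - d n >= - c e^2 *)
have -> : d ^+ 2 / c = c * (d / c) ^+ 2 by field; rewrite gt_eqF.
have dE : d * `|x| = c * (d / c) * `|x| by field; rewrite gt_eqF.
move: (d / c) dE => e dE.
have : 0 <= c * (`|x| - e) ^+ 2 by rewrite mulr_ge0// ?sqr_ge0// ltW.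
have : 0 <= c * (`|x|) ^+ 2 by rewrite mulr_ge0// ?sqr_ge0// ltW.
have : 0 <= c * e ^+ 2 by rewrite mulr_ge0// ?sqr_ge0// ltW.
nra.
Qed.

Lemma dual_fin_num y : (- ereal_inf (range (L y)))%E \is a fin_num.
Proof.
rewrite fin_numN fin_numElt; have [s sE] := lagrangian_x0_fin y.
have [m mP] := lagrangian_lower_bounded y.
apply/andP; split.
  apply: (@lt_le_trans _ _ m%:E); first exact: ltNyr.
  by apply: le_ereal_inf_tmp => _ [x _ <-].
apply: (@le_lt_trans _ _ s%:E); last exact: ltry.
by rewrite -sE; apply: ereal_inf_lbound; exists x0.
Qed.

Lemma dualE y : ereal_inf (range (L y)) = (- phi y)%:E.
Proof. by rewrite /dual_value EFinN fineK ?dual_fin_num// oppeK. Qed.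

Lemma dual_le y x : ((- phi y)%:E <= L y x)%E.
Proof. by rewrite -dualE; apply: ereal_inf_lbound; exists x. Qed.

Lemma minimizersP y x : minimizers y x <-> L y x = (- phi y)%:E.
Proof.
split=> [xmin|xE x']; last by rewrite xE; exact: dual_le.
apply/eqP; rewrite eq_le dual_le andbT -dualE.
by apply: le_ereal_inf_tmp => _ [x' _ <-].
Qed.

(** Weierstrass for a lower semicontinuous function: if the infimum m were not
    attained, every point of a ball containing the level set of m + 1 would have
    a neighbourhood where the values exceed a constant above m; compactness
    gives one constant e > m for the whole ball, and outside the ball the values
    exceed m + 1, so m would not be the infimum. *)
Lemma minimizers_neq0 y : minimizers y !=set0.
Proof.
apply: contrapT => nomin.
have gt_inf x : ((- phi y)%:E < L y x)%E.
  rewrite lt_neqAle dual_le andbT; apply/eqP => xE.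
  by apply: nomin; exists x; apply/minimizersP.
have [M MP] := lagrangian_level_bounded `|y| (- phi y + 1) (normr_ge0 y).
have /compact_near_coveringP cM := @compact_norm_le R X M.
have : \forall e \near (- phi y)^'+,
    [set x : X | `|x| <= M] `<=` (fun x => (e%:E < L y x)%E).
  apply: (cM R _ (fun e x => (e%:E < L y x)%E)) => x _.
  have [e0 e0gt e0lt] := lte_fin_between _ _ (gt_inf x).
  have near_e : \forall e \near (- phi y)^'+, e < e0 by exact: nbhs_right_lt.
  have near_x : \forall x' \near x, (e0%:E < L y x')%E.
    have cyx : (y, x') @[x' --> x] --> (y, x).
      by apply: cvg_pair; [exact: cvg_cst|exact: cvg_id].
    exact: (cyx _ (lagrangian_lsc _ _ _ e0lt)).
  near=> x' e => /=; apply: (@lt_trans _ _ e0%:E); last by near: x'.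
  by rewrite lte_fin; near: e.
move=> near_e; have [e [e_gt [e_lt eP]]] : exists e : R,
    - phi y < e /\ e < - phi y + 1 /\
    [set x : X | `|x| <= M] `<=` (fun x => (e%:E < L y x)%E).
  near (- phi y)^'+ => e; exists e; split; last split.
  - by near: e; exact: nbhs_right_gt.
  - by near: e; apply: nbhs_right_lt; rewrite ltrDl.
  - by near: e.
have : (e%:E <= ereal_inf (range (L y)))%E.
  apply: le_ereal_inf_tmp => _ [x _ <-].
  have [xM|xM] := leP `|x| M; first by apply/ltW/eP.
  rewrite leNgt; apply/negP => lag_lt.
  have : `|x| <= M.
    by apply: (MP y) => //; apply/ltW/(lt_trans lag_lt); rewrite lte_fin.
  by rewrite leNgt xM.
by rewrite dualE lee_fin leNgt e_gt.
Unshelve. all: by end_near. Qed.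

(** The affine function of slope A x - b that the Lagrangian of a fixed x
    defines lies below phi everywhere and meets it at y. *)
Lemma dual_ge_affine y y' x : minimizers y x ->
  phi y + inner (A x - b) (y' - y) <= phi y'.
Proof.
move=> /minimizersP Lyx; have := dual_le y' x.
have -> : L y' x = (L y x + (inner (y' - y) (b - A x))%:E)%E.
  by rewrite /lagrangian -addeA -EFinD innerBl subrKC.
rewrite Lyx -EFinD lee_fin -[b - A x]opprB innerNr (innerC (y' - y)); lra.
Qed.

(** A minimizer is at most as costly as the fixed point x0, so it lies in a
    level set of the Lagrangian that is uniform for y in a ball. *)
Lemma minimizers_bounded r : exists2 M, 0 <= M &
  forall y x, `|y| <= r -> minimizers y x -> `|x| <= M.
Proof.
have [s sE] := lagrangian_x0_fin 0.
have r0 : 0 <= Num.max r 0 by rewrite le_max lexx orbT.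
have [M MP] := lagrangian_level_bounded _ (s + Num.max r 0 * `|b - A x0|) r0.
exists (Num.max M 0) => [|y x yr xmin]; first by rewrite le_max lexx orbT.
rewrite le_max (MP y x)//; first by rewrite le_max yr.
apply: le_trans (xmin x0) _.
have -> : L y x0 = (L 0%R x0 + (inner y (b - A x0))%:E)%E.
  by rewrite /lagrangian inner0l adde0.
rewrite sE -EFinD lee_fin lerD2l; apply: le_trans (inner_le _ _) _.
by rewrite ler_wpM2r// le_max yr.
Qed.

(** On a ball the slopes A x - b, for x minimizing, are uniformly bounded, and
    the affine minorants at the two points bound the increment of phi both
    ways. *)
Lemma dual_lipschitz r : exists2 k, 0 <= k &
  forall y y', `|y| <= r -> `|y'| <= r -> `|phi y - phi y'| <= k * `|y - y'|.
Proof.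
have [C C0 AC] := linear_bounded_finHilbert A.
have [M M0 MP] := minimizers_bounded r.
exists (C * M + `|b|) => [|y y' yr y'r]; first by rewrite addr_ge0// mulr_ge0.
have slope u v : `|u| <= r -> phi u - phi v <= (C * M + `|b|) * `|u - v|.
  move=> ur; have [x xmin] := minimizers_neq0 u.
  have := dual_ge_affine u v x xmin; have := inner_le (A x - b) (u - v).
  have -> : inner (A x - b) (v - u) = - inner (A x - b) (u - v).
    by rewrite -innerNr opprB.
  have : `|A x - b| <= C * M + `|b|.
    apply: le_trans (ler_normB _ _) _; rewrite lerD2r.
    by apply: le_trans (AC x) _; rewrite ler_wpM2l// (MP u).
  move=> /(ler_wpM2r (normr_ge0 (u - v))); lra.
by rewrite ler_norml slope// andbT lerNl opprB distrC slope.
Qed.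

Lemma dual_continuous : continuous phi.
Proof.
move=> y; have [k k0 kP] := dual_lipschitz (`|y| + 1).
apply/cvgrPdist_le => e e0; near=> y'.
apply: le_trans (kP _ _ _ _) _; first by rewrite lerDl.
  by near: y'; exact: near_norm_le.
apply: (@le_trans _ _ ((k + 1) * `|y - y'|)).
  by rewrite ler_wpM2r// lerDl.
rewrite mulrC -ler_pdivlMr ?ltr_wpDl// ltW//; near: y'.
by apply: near_dist_lt; rewrite divr_gt0// ltr_wpDl.
Unshelve. all: by end_near. Qed.

(** Minimality is the equality of the Lagrangian, jointly lower semicontinuous,
    with - phi, continuous in y; a strict inequality persists nearby. *)
Lemma minimizers_closed_graph y x : ~ minimizers y x ->
  \forall p \near (y, x), ~ minimizers p.1 p.2.
Proof.
move=> xnmin.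
have : ((- phi y)%:E < L y x)%E.
  by rewrite lt_neqAle dual_le andbT; apply/eqP => /esym/minimizersP.
move=> /lte_fin_between[a agt alt].
have near_phi : \forall p \near (y, x), - a < phi p.1.
  have /cvgr_gt := dual_continuous y => /(_ (- a)).
  rewrite ltrNl => /(_ agt) near_a.
  have c1 : q.1 @[q --> (y, x)] --> y by exact: cvg_fst.
  exact: (c1 _ near_a).
near=> p; move=> /minimizersP; apply/eqP; rewrite gt_eqF//.
apply: (@lt_trans _ _ a%:E); last by near: p; exact: lagrangian_lsc.
by rewrite lte_fin ltrNl; near: p.
Unshelve. all: by end_near. Qed.

(** Upper semicontinuity of the argmin: the minimizers for nearby multipliers
    stay in one compact ball, and each point of it has a neighbourhood that is
    either inside O or, by the closed graph, free of such minimizers. *)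
Lemma minimizers_usc y (O : set X) : open O -> minimizers y `<=` O ->
  \forall y' \near y, minimizers y' `<=` O.
Proof.
move=> oO yO; have [M M0 MP] := minimizers_bounded (`|y| + 1).
have /compact_near_coveringP cM := @compact_norm_le R X M.
have near_O : \forall y' \near y,
    [set x : X | `|x| <= M] `<=` (fun x => minimizers y' x -> O x).
  apply: (cM Y _ (fun y' x => minimizers y' x -> O x)) => x _.
  have [xmin|xnmin] := pselect (minimizers y x).
    have Ox : \forall x' \near x, O x'.
      by apply: open_nbhs_nbhs; split=> //; exact: yO.
    have c1 : q.1 @[q --> (x, y)] --> x by exact: cvg_fst.
    have Ox1 : \forall q \near (x, y), O q.1 by exact: (c1 _ Ox).
    by near=> q => _; near: q.
  have := minimizers_closed_graph _ _ xnmin.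
  have cyx : (q.2, q.1) @[q --> (x, y)] --> (y, x).
    by apply: cvg_pair; [exact: cvg_snd|exact: cvg_fst].
  move=> /cyx xnmin'.
  have {}xnmin' : \forall q \near (x, y), ~ minimizers q.2 q.1 by exact: xnmin'.
  by near=> q => qmin; exfalso; move: qmin; near: q.
near=> y' => x xmin.
have := near near_O y'; apply => //=.
by apply: (MP y') => //; near: y'; exact: near_norm_le.
Unshelve. all: by end_near. Qed.

Lemma minimizers_compact y : compact (minimizers y).
Proof.
have [M _ MP] := minimizers_bounded `|y|.
apply: (subclosed_compact _ (@compact_norm_le R X M)) => [|x xmin]; last first.
  exact: (MP y).
rewrite -openC openE => x xnmin.
have cyx : (y, x') @[x' --> x] --> (y, x).
  by apply: cvg_pair; [exact: cvg_cst|exact: cvg_id].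
exact: (cyx _ (minimizers_closed_graph _ _ xnmin)).
Qed.

(** At the intermediate point w the function equals an affine minorant, whose
    values at the end points are at most those of phi. *)
Lemma dual_convex : convex_function [set: Y] phi.
Proof.
move=> t u v _ _.
have -> : conv t (phi u : R^o) (phi v) =
    t%:num * phi u + (1 - t%:num) * phi v by [].
have -> : conv t (u : convex_lmodType Y) v =
    t%:num *: u + (1 - t%:num) *: v by [].
set w := _ + _; have [x xmin] := minimizers_neq0 w.
have := dual_ge_affine w u x xmin; have := dual_ge_affine w v x xmin.
have -> : v - w = t%:num *: (v - u).
  by rewrite /w scalerBl scale1r addrCA opprD addrA subrr add0r opprB -scalerBr.
have -> : u - w = (1 - t%:num) *: (u - v).
  by rewrite /w opprD addrA -{1}[u]scale1r -scalerBl -scalerBr.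
rewrite !innerZr -[v - u]opprB innerNr.
have : 0 <= t%:num by []. have : t%:num <= 1 by [].
move: (inner _ _) (phi u) (phi v) (phi w) => i pu pv pw.
move: (t%:num) => s s1 s0 hv hu.
have := ler_wpM2l s0 hu; have := ler_wpM2l (_ : 0 <= 1 - s) hv; nra.
Qed.

(** For the nontrivial inclusion, suppose that in some direction d all slopes
    at y lie strictly below <g, d>. Upper semicontinuity extends this to
    y + t d for small t > 0, where a minimizer gives
    phi (y + t d) - phi y <= t <A x - b, d> < t <g, d>, against the subgradient
    inequality for g. *)
Lemma dual_subdifferential y :
  subdifferential phi y = convex_hull [set A x - b | x in minimizers y].
Proof.
apply/seteqP; split=> [g gP|]; last first.
  apply: smallest_sub => [|_ [x xmin <-] y']; last exact: dual_ge_affine.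
  apply/convex_setP => g g' t gP g'P /andP[t0 t1] y'.
  rewrite innerDl !innerZl.
  have := ler_wpM2l t0 (gP y'); have : 0 <= 1 - t by rewrite subr_ge0.
  by move=> t1'; have := ler_wpM2l t1' (g'P y'); lra.
apply: mem_convex_hull_compact => [|d].
  apply: continuous_compact; last exact: minimizers_compact.
  apply: continuous_subspaceT => x; apply: cvgB; last exact: cvg_cst.
  exact: linear_continuous_finHilbert.
apply: contrapT => nk.
pose O : set X := [set x | inner (A x - b) d < inner g d].
have oO : open O.
  have cO : continuous (fun x : X => inner (A x - b) d).
    move=> x.
    have cA : A x' - b @[x' --> x] --> A x - b.
      by apply: cvgB; [exact: linear_continuous_finHilbert|exact: cvg_cst].
    exact: (cvg_comp _ _ (cvg_pair cA (cvg_cst d))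
      (inner_continuous (A x - b, d))).
  by have /continuousP/(_ _ (@open_lt R (inner g d))) := cO.
have yO : minimizers y `<=` O.
  move=> x xmin; rewrite /O /= ltNge; apply/negP => gd.
  by apply: nk; exists (A x - b) => //; exists x.
have [t t0 tO] : exists2 t : R, 0 < t & minimizers (y + t *: d) `<=` O.
  have cyd : y + t *: d @[t --> (0 : R)^'+] --> y.
    rewrite -[X in _ --> X]addr0 -[X in _ --> _ + X](scale0r d).
    apply: cvgD; first exact: cvg_cst.
    by apply: cvgZr_tmp; apply: cvg_at_right_filter; exact: cvg_id.
  have near_t := cyd _ (minimizers_usc y O oO yO).
  near (0 : R)^'+ => t; exists t; first by near: t; exact: nbhs_right_gt.
  by near: t.
have [x xmin] := minimizers_neq0 (y + t *: d).
have := dual_ge_affine _ y x xmin; have := gP (y + t *: d).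
rewrite opprD addrA subrr add0r [y + _]addrC addrK innerNr !innerZr.
have := tO x xmin; rewrite /O /= -(ltr_pM2l t0); lra.
Unshelve. all: by end_near. Qed.

(** The remainder phi (v + y) - phi y - <g, v> is nonnegative by the minorant at
    y, and at most <A x' - A x, v> by the minorant at v + y, where x' is a
    minimizer for v + y; upper semicontinuity makes |A x' - A x| small with v. *)
Lemma dual_gradient y x : minimizers y = [set x] ->
  is_gradient phi y (A x - b).
Proof.
move=> yx; set g := A x - b.
have xmin : minimizers y x by rewrite yx.
have g_lin : linear (inner g : Y -> R^o).
  by move=> a u v; rewrite innerDr innerZr.
pose G : {linear Y -> R^o} :=
  HB.pack (inner g : Y -> R^o) (GRing.isLinear.Build _ _ _ _ _ g_lin).
have Gc : continuous G by exact: linear_continuous_finHilbert.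
have phi_o : phi \o shift y = cst (phi y) + G +o_ 0 id.
  apply/eqaddoP => e e0 /=.
  pose O : set X := [set x' | `|A x' - A x| < e].
  have oO : open O.
    have cO : continuous (fun x' : X => `|A x' - A x|).
      move=> x'; apply: cvg_norm; apply: cvgB; last exact: cvg_cst.
      exact: linear_continuous_finHilbert.
    by have /continuousP/(_ _ (@open_lt R e)) := cO.
  have yO : minimizers y `<=` O.
    by rewrite yx => _ ->; rewrite /O /= subrr normr0.
  have cy : v + y @[v --> (0 : Y)] --> y.
    rewrite -[X in _ --> X]add0r; apply: cvgD; [exact: cvg_id|exact: cvg_cst].
  have near_v := cy _ (minimizers_usc y O oO yO).
  near=> v.
  have vO : minimizers (v + y) `<=` O by near: v.
  have [x' x'min] := minimizers_neq0 (v + y).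
  have lo := dual_ge_affine y (v + y) x xmin.
  have hi := dual_ge_affine (v + y) y x' x'min.
  rewrite addrK in lo; rewrite opprD addrCA subrr addr0 innerNr in hi.
  have gap : inner (A x' - A x) v <= e * `|v|.
    apply: le_trans (inner_le _ _) _; rewrite ler_wpM2r// ltW//.
    exact: (vO x' x'min).
  have gE : A x' - A x = (A x' - b) - g by rewrite /g opprB addrA subrK.
  rewrite gE innerBl in gap.
  have -> : (phi \o shift y - (cst (phi y) + G)) v =
    phi (v + y) - (phi y + inner g v) by [].
  by rewrite /= ger0_norm; [lra|rewrite subr_ge0].
have dG := diff_unique Gc phi_o.
split; last by move=> v; rewrite dG.
by apply/diff_locallyP; rewrite dG.
Unshelve. all: by end_near. Qed.

End DualOfCoercive.

(** * The proximal objective *)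

(** The function h of the primal problem: the multiplier y enters the dual only
    through the linear term <y, b - A x>. *)
Definition regularized {R : realType} {X : finHilbertType R} (lambda : R)
    (f : X -> \bar R) (z : X) (x : X) : \bar R :=
  (scale_fun lambda f x + (2^-1 * `|x - z| ^+ 2)%:E)%E.

Lemma regularized_lsc {R : realType} {X : finHilbertType R} (lambda : R)
    (f : X -> \bar R) (z : X) :
  0 < lambda -> lower_semicontinuous f ->
  lower_semicontinuous (regularized lambda f z).
Proof.
move=> l0 f_lsc x a a_lt.
suff a_near : \forall y \near x, (a%:E < regularized lambda f z y)%E.
  by exists [set y | (a%:E < regularized lambda f z y)%E].
apply: near_lt_lsc_add a_lt => [a'|].
  rewrite /scale_fun -lte_pdivrMl// -EFinM => /f_lsc[V Vx Vf].
  by apply: filterS Vx => y /Vf; rewrite EFinM lte_pdivrMl.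
have c1 : `|y - z| @[y --> x] --> `|x - z|.
  by apply: cvg_norm; apply: cvgB; [exact: cvg_id|exact: cvg_cst].
by apply: cvgM; [exact: cvg_cst|exact: (cvgM c1 c1)].
Qed.

(** With kappa = lambda / gamma < 1, the lower bound on gamma f costs at most
    kappa / 2 |x - x0|^2, and (1 - kappa) / 2 |x|^2 survives up to terms that
    are linear in |x|; half of it absorbs them. *)
Lemma regularized_coercive {R : realType} {X : finHilbertType R} (lambda : R)
    (f : X -> \bar R) (z : X) :
  0 < lambda -> (forall x, -oo < f x)%E -> (lambda%:E < prox_threshold f)%E ->
  exists c, exists2 beta, 0 < c &
    forall x, ((c * `|x| ^+ 2 - beta)%:E <= regularized lambda f z x)%E.
Proof.
move=> l0 fNy /ereal_sup_gt[_ [gamma [g0 [x0 env_gt]] <-]].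
rewrite lte_fin => lg.
(* the envelope may be +oo here, in which case any m will do *)
have [m mP] : exists m : R, forall x,
    (m%:E <= (gamma%:E * f x) + (2^-1 * `|x - x0| ^+ 2)%:E)%E.
  have [m env_m] :
      exists m : R, (m%:E <= moreau_envelope (scale_fun gamma f) x0)%E.
    move: env_gt; case: (moreau_envelope _ _) => [r _| _|//]; first by exists r.
    by exists 0; rewrite leey.
  exists m => x; apply: (le_trans env_m).
  by apply: ereal_inf_lbound; exists x.
pose kappa := lambda / gamma.
have k0 : 0 < kappa by rewrite divr_gt0.
have k1 : kappa < 1 by rewrite ltr_pdivrMr// mul1r.
pose d := kappa * `|x0| + `|z|.
exists ((1 - kappa) / 4).
exists (d ^+ 2 / (1 - kappa) + kappa / 2 * `|x0| ^+ 2 - kappa * m) => [|x].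
  by rewrite divr_gt0// subr_gt0.
rewrite /regularized /scale_fun.
case fx : (f x) (fNy x) => [r| |//] _; last first.
  by rewrite gt0_muley ?lte_fin// addye// leey.
have := mP x; rewrite fx -!EFinM -!EFinD !lee_fin => mr.
have := ler_wpM2l (ltW k0) mr.
rewrite mulrDr mulrA divfK ?gt_eqF// !sqr_normB.
have i1 := inner_le x z.
have i2 : - inner x x0 <= `|x| * `|x0|.
  by rewrite -innerNr; apply: le_trans (inner_le _ _) _; rewrite normrN.
have := ler_wpM2l (ltW k0) i2.
have dE : d ^+ 2 / (1 - kappa) = (1 - kappa) * (d / (1 - kappa)) ^+ 2.
  by field; rewrite subr_eq0 eq_sym lt_eqF.
have dE' : d * `|x| = (1 - kappa) * (d / (1 - kappa)) * `|x|.
  by field; rewrite subr_eq0 eq_sym lt_eqF.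
(* the square that splits the linear term d |x| *)
have : 0 <= (1 - kappa) * (2^-1 * `|x| - d / (1 - kappa)) ^+ 2.
  by rewrite mulr_ge0 ?sqr_ge0// subr_ge0 ltW.
rewrite dE; move: (d / (1 - kappa)) dE' => e; rewrite /d => dE'.
have : 0 <= `|z| ^+ 2 by exact: sqr_ge0.
move: (inner x z) (inner x x0) i1 i2 dE' => a a'.
move: `|x| `|z| `|x0| => n nz n0 i1 i2 dE' hz hsq hk hm.
nra.
Qed.

(** Completing the square: the proximal objective at z + A^* y and the
    Lagrangian differ by the constant k, independent of x. *)
Lemma prox_argmin {R : realType} {X Y : finHilbertType R} (lambda : R)
    (f : X -> \bar R) (A : {linear X -> Y}) (z : X) (b : Y) (y : Y) :
  prox (scale_fun lambda f) (z + adjoint A y) =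
  lagrangian_argmin (regularized lambda f z) A b y.
Proof.
set w := adjoint A y.
pose k : R := inner z w + 2^-1 * `|w| ^+ 2 - inner y b.
have kE x : prox_objective (scale_fun lambda f) (z + w) x =
    (lagrangian (regularized lambda f z) A b y x + k%:E)%E.
  rewrite /prox_objective /lagrangian /regularized -!addeA -!EFinD.
  congr (_ + _%:E)%E.
  have -> : x - (z + w) = (x - z) - w by rewrite opprD addrA.
  rewrite (sqr_normB (x - z)) innerBl innerBr (innerC y (A x)) adjointP /k.
  by rewrite -/w; field.
by apply/seteqP; split=> x xmin x'; have := xmin x'; rewrite !kE leeD2rE.
Qed.

Theorem proposition2 (R : realType) (X Y : finHilbertType R)
    (lambda : R) (z : X) (b : Y) (f : X -> \bar R) (A : {linear X -> Y}) :
  0 < lambda ->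
  proper_efun f ->
  lower_semicontinuous f ->
  prox_bounded f ->
  (lambda%:E < prox_threshold f)%E ->
  set_surj [set: X] [set: Y] A ->
  [set x | edom f x /\ A x = b] !=set0 ->
  let Phi : Y -> \bar R := dual_objective lambda f A z b in
  let phi : Y -> R^o := fun y => fine (Phi y) in
  let P : Y -> set X :=
    fun y => prox (scale_fun lambda f) (z + adjoint A y) in
  (forall y, Phi y \is a fin_num) /\
  [/\ [/\ continuous phi,
          convex_function [set: Y] phi &
          (forall y : Y, exists2 U : set Y,
            nbhs y U & [lipschitz phi u | u in U])],
      (forall y, subdifferential phi y =
         convex_hull [set A x - b | x in P y]) &
      (forall (y : Y) (x : X), P y = [set x] ->
         is_gradient phi y (A x - b))].
Proof.
move=> l0 [fNy [x0 fx0]] f_lsc _ lt_thr _ _ Phi phi P.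
pose h := regularized lambda f z.
have [c [beta c0 h_coer]] := regularized_coercive lambda f z l0 fNy lt_thr.
have h_lsc := regularized_lsc lambda f z l0 f_lsc.
have h_x0 : (h x0 < +oo)%E.
  rewrite /h /regularized /scale_fun; move: fx0 (fNy x0); rewrite /edom /=.
  by case: (f x0) => // r _ _; rewrite -EFinM -EFinD ltry.
have PE y : P y = lagrangian_argmin h A b y by exact: prox_argmin.
have phiE : phi = dual_value h A b by [].
split=> [y|]; first exact: (dual_fin_num h A b c beta x0).
rewrite phiE; split; first split.
- exact: (dual_continuous h A b c beta x0).
- exact: (dual_convex h A b c beta x0).
- move=> y; exists [set u | `|u| <= `|y| + 1]; first exact: near_norm_le.
  have [k _ kP] :=
    dual_lipschitz h A b c beta x0 c0 h_coer h_lsc h_x0 (`|y| + 1).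
  have yy : `|y| <= `|y| + 1 by rewrite lerDl.
  apply: (@klipschitzW _ _ _ k) => [|[u v] [/= uy vy]]; last exact: kP.
  by apply: (@globally_properfilter _ _ (y, y)).
- by move=> y; rewrite PE; exact: (dual_subdifferential h A b c beta x0).
- by move=> y x; rewrite PE; exact: (dual_gradient h A b c beta x0).
Qed.
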